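(* Let $(m,n)$ be bi-dimensions with $m>1$, $m\le\binom n2$, and $(m,n)\notin\{(2,4),(3,4)\}$. Then a generic real algebra $\mathfrak n\in N(m,n)$ is not of pseudo $H$-type (in particular, for $m>2$ generic rigid algebras in $N(m,n)$ are not of pseudo $H$-type).
   Context: For a real vector space $\mathfrak n_{-1}$ of dimension $n$ and $0\le m\le\binom n2$, $N(m,n)$ denotes the space of graded 2-step nilpotent Lie algebra structures $\mathfrak n=\mathfrak n_{-2}\oplus\mathfrak n_{-1}$ with $\dim\mathfrak n_{-2}=m$, bracket $\Lambda^2\mathfrak n_{-1}\to\mathfrak n_{-2}$ surjective and $\mathfrak n_{-2}$ central; it is identified with the Grassmannian $\operatorname{Gr}_d(\Lambda^2\mathfrak n_{-1})$, $d=\binom n2-m$, via the kernel $Z$ of the bracket. ''Generic'' means for $Z$ in a nonempty Zariski open subset. An algebra $\mathfrak n$ is of pseudo $H$-type if there is a non-degenerate symmetric bilinear form $\langle\cdot,\cdot\rangle$ on $\mathfrak n$, non-degenerate on $\mathfrak n_{-2}$, with $\mathfrak n_{-2}\perp\mathfrak n_{-1}$, such that the $J$-map defined by $\langle J_zx,y\rangle=\langle z,[x,y]\rangle$ ($x,y\in\mathfrak n_{-1}$, $z\in\mathfrak n_{-2}$) satisfies $J_zJ_w+J_wJ_z=-2\langle z,w\rangle\mathrm{Id}_{\mathfrak n_{-1}}$ for all $z,w\in\mathfrak n_{-2}$. An algebra is rigid if its Tanaka prolongation (the maximal graded Lie algebra $\bigoplus_{i\ge-2}\hat{\mathfrak n}_i$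 with negative part $\mathfrak n$ such that for $k\ge0$ any $X\in\hat{\mathfrak n}_k$ with $[X,\mathfrak n_{-1}]=0$ is zero) is finite dimensional. *)

(* Defs.v *)
From HB Require Import structures.
From mathcomp Require Import all_boot all_order all_algebra.
From mathcomp Require Import reals.
From mathcomp Require Import mpoly.
Set Implicit Arguments. Unset Strict Implicit. Unset Printing Implicit Defensive.
Import GRing.Theory.
Local Open Scope ring_scope.

(* A graded 2-step nilpotent algebra n = n_{-2} (+) n_{-1} with
   n_{-1} = R^n (column vectors 'cV_n) and n_{-2} = R^m ('cV_m) is given by
   structure constants: A k (k < m) is the skew-symmetric n x n matrix with
   [x,y]_k = x^T (A k) y.  n_{-2} is central by construction. *)
Definition struct_const (R : realType) (m n : nat) := 'I_m -> 'M[R]_n.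

Definition skew_consts (R : realType) m n (A : struct_const R m n) : Prop :=
  forall k, (A k)^T = - A k.

Definition bracket (R : realType) m n (A : struct_const R m n)
  (x y : 'cV[R]_n) : 'cV[R]_m :=
  \col_k (x^T *m A k *m y) 0 0.

Definition bracket_surjective (R : realType) m n (A : struct_const R m n) : Prop :=
  forall v : 'cV[R]_m, exists c : 'M[R]_n,
    v = \sum_(i < n) \sum_(j < n) c i j *: bracket A (delta_mx i 0) (delta_mx j 0).

Definition bform (R : realType) p (S : 'M[R]_p) (u v : 'cV[R]_p) : R :=
  (u^T *m S *m v) 0 0.

(* Pseudo H-type.  A non-degenerate symmetric form on n with
   n_{-2} orthogonal to n_{-1} is the orthogonal sum of a symmetric form S1 on
   n_{-1} and a symmetric form S2 on n_{-2}; non-degeneracy of the whole form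
   together with non-degeneracy on n_{-2} means both S1 and S2 are invertible.
   J z is the J-map:  <J_z x, y> = <z, [x,y]>. *)
Definition pseudo_H_type (R : realType) m n (A : struct_const R m n) : Prop :=
  exists (S1 : 'M[R]_n) (S2 : 'M[R]_m) (J : 'cV[R]_m -> 'M[R]_n),
    [/\ S1^T = S1 /\ S1 \in unitmx, S2^T = S2 /\ S2 \in unitmx,
        (forall z x y, bform S1 (J z *m x) y = bform S2 z (bracket A x y))
      & (forall z w, J z *m J w + J w *m J z = scalar_mx (- 2 * bform S2 z w))].

Definition sc_coords (R : realType) m n (A : struct_const R m n) :
  'I_(m * (n * n)) -> R :=
  fun i => (mxvec (\matrix_(k < m, ij < n * n) (mxvec (A k)) 0 ij)) 0 i.

(* "generic": the property holds on a nonempty Zariski open subset of the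
   space of algebras, i.e. wherever some real polynomial P in the structure
   constants does not vanish, P being nonzero at some algebra of N(m,n). *)
Definition generic_in_N (R : realType) (m n : nat)
  (Prop_ : struct_const R m n -> Prop) : Prop :=
  exists P : {mpoly R[m * (n * n)]},
    (exists A0 : struct_const R m n,
        [/\ skew_consts A0, bracket_surjective A0 & P.@[sc_coords A0] != 0]) /\
    (forall A : struct_const R m n,
        skew_consts A -> bracket_surjective A -> P.@[sc_coords A] != 0 ->
        Prop_ A).

(* Main.v *)
Require Import Defs.
From HB Require Import structures.
From mathcomp Require Import all_boot all_order all_algebra.
From mathcomp Require Import zify ring lra.
From mathcomp Require Import reals.
From mathcomp Require Import mpoly.

(** If [n] is of pseudo H-type, [J_z^2 = - <z,z>] with [J_z] skew-adjoint, so
    [n] is even, and for an anisotropic [x] the vectors [x] and [J_z x] span a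
    nondegenerate space of dimension [m + 1], so [m < n].  The only remaining
    cases are [n] even with [n >= 6].  There [A_k^-1 A_l] is proportional to
    [J_z J_w], hence is a root of a quadratic polynomial, while for a generic
    pencil its minimal polynomial has degree [n / 2 >= 3]. *)

Set Implicit Arguments. Unset Strict Implicit. Unset Printing Implicit Defensive.
Import Order.TTheory GRing.Theory Num.Theory.
Local Open Scope ring_scope.

(** * Symmetric bilinear forms *)

Lemma bform_delta (R : realType) p (S : 'M[R]_p) (i j : 'I_p) :
  bform S (delta_mx i 0) (delta_mx j 0) = S i j.
Proof. by rewrite /bform trmx_delta -rowE -colE !mxE. Qed.

Lemma bformDl (R : realType) p (S : 'M[R]_p) (u v w : 'cV[R]_p) :
  bform S (u + v) w = bform S u w + bform S v w.
Proof. by rewrite /bform [(u + v)^T]linearD /= !mulmxDl mxE. Qed.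

Lemma bformDr (R : realType) p (S : 'M[R]_p) (u v w : 'cV[R]_p) :
  bform S u (v + w) = bform S u v + bform S u w.
Proof. by rewrite /bform mulmxDr mxE. Qed.

Lemma bformC (R : realType) p (S : 'M[R]_p) (u v : 'cV[R]_p) :
  S^T = S -> bform S u v = bform S v u.
Proof.
move=> Ssym; rewrite /bform; transitivity ((u^T *m S *m v)^T 0 0).
  by rewrite [RHS]mxE.
by rewrite !trmx_mul trmxK Ssym mulmxA.
Qed.

(** If the diagonal of [S] vanishes, the form takes the value [2 S i j] at [e_i + e_j]; were this
    always zero, [S] would be 0, hence not invertible as [0 < p]. *)
Lemma exists_anisotropic (R : realType) p (S : 'M[R]_p) :
  (0 < p)%N -> S^T = S -> S \in unitmx -> exists z, bform S z z != 0.
Proof.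
move=> p_gt0 Ssym Sunit.
have [/existsP[i Sii]|/existsPn diag0] := boolP [exists i, S i i != 0].
  by exists (delta_mx i 0); rewrite bform_delta.
have Sii i : S i i = 0 by apply/eqP/negPn/diag0.
have [/existsP[ij Sij]|/existsPn S0] :=
    boolP [exists ij : 'I_p * 'I_p, S ij.1 ij.2 != 0].
  case: ij Sij => i j /= Sij; exists (delta_mx i 0 + delta_mx j 0).
  have -> : bform S (delta_mx i 0 + delta_mx j 0) (delta_mx i 0 + delta_mx j 0)
      = S i j *+ 2.
    have Sji : S j i = S i j by rewrite -{1}Ssym mxE.
    by rewrite !bformDl !bformDr !bform_delta Sji !Sii; ring.
  by rewrite mulrn_eq0.
have S_eq0 : S = 0.
  by apply/matrixP=> i j; rewrite mxE; apply/eqP/negPn/(S0 (i, j)).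
by case: p p_gt0 S S_eq0 Sunit {Ssym diag0 Sii S0} => // p _ S ->; rewrite unitr0.
Qed.

(** * Consequences of the J-map relations *)

Section JMap.
Variables (R : realType) (m n : nat) (A : struct_const R m n).
Variables (S1 : 'M[R]_n) (S2 : 'M[R]_m) (J : 'cV[R]_m -> 'M[R]_n).
Hypotheses (Askew : skew_consts A) (S1sym : S1^T = S1) (S2sym : S2^T = S2).
Hypotheses (S1unit : S1 \in unitmx) (S2unit : S2 \in unitmx).
Hypothesis JP : forall z x y, bform S1 (J z *m x) y = bform S2 z (bracket A x y).
Hypothesis JJ : forall z w,
  J z *m J w + J w *m J z = scalar_mx (- 2 * bform S2 z w).

Lemma trJ_mul z : (J z)^T *m S1 = \sum_k (z^T *m S2) 0 k *: A k.
Proof.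
apply/matrixP=> i j.
have -> : ((J z)^T *m S1) i j = bform S1 (J z *m delta_mx i 0) (delta_mx j 0).
  by rewrite -bform_delta /bform trmx_mul !mulmxA.
rewrite JP /bform [LHS]mxE summxE; apply: eq_bigr => k _.
by rewrite [RHS]mxE -(bform_delta (A k)) [bracket _ _ _ _ _]mxE.
Qed.

(** By [trJ_mul], [S1 *m J z] is the transpose of a linear combination of the skew matrices
    [A k]. *)
Lemma trJ_skew z : (J z)^T *m S1 = - (S1 *m J z).
Proof.
have -> : S1 *m J z = ((J z)^T *m S1)^T by rewrite trmx_mul trmxK S1sym.
rewrite trJ_mul linear_sum -sumrN; apply: eq_bigr => k _ /=.
by rewrite linearZ /= Askew scalerN opprK.
Qed.

Lemma J_orthogonal z x : bform S1 (J z *m x) x = 0.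
Proof.
have bC := bformC (J z *m x) x S1sym.
have : bform S1 (J z *m x) x = - bform S1 x (J z *m x).
  by rewrite /bform trmx_mul -!mulmxA [_ *m (S1 *m _)]mulmxA trJ_skew
             mulNmx mulmxN mxE !mulmxA.
rewrite -bC; lra.
Qed.

(** Skew-adjointness moves [J z] across the form; symmetrising in [z] and [w] then brings in the
    Clifford relation [JJ]. *)
Lemma J_gram z w x : bform S1 (J z *m x) (J w *m x) = bform S1 x x * bform S2 z w.
Proof.
have bE z' w' : bform S1 (J z' *m x) (J w' *m x) =
    - (x^T *m S1 *m (J z' *m J w') *m x) 0 0.
  rewrite /bform trmx_mul -!mulmxA [_ *m (S1 *m _)]mulmxA trJ_skew.
  by rewrite mulNmx mulmxN mxE !mulmxA.
have bC := bformC (J z *m x) (J w *m x) S1sym.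
have : bform S1 (J z *m x) (J w *m x) + bform S1 (J w *m x) (J z *m x) =
    2 * (bform S1 x x * bform S2 z w).
  rewrite !bE -opprD; set a := (_ *m x) 0 0; set b := (_ *m x) 0 0.
  have -> : a + b = (x^T *m S1 *m (J z *m J w + J w *m J z) *m x) 0 0.
    by rewrite mulmxDr mulmxDl [RHS]mxE.
  by rewrite JJ mul_mx_scalar -scalemxAl mxE /bform; ring.
rewrite -bC; lra.
Qed.

Lemma dim_center_lt : (0 < n)%N -> (m < n)%N.
Proof.
move=> n_gt0; rewrite ltnNge; apply/negP => n_le_m.
have [x xx] := exists_anisotropic n_gt0 S1sym S1unit.
(* The rows of [W] are the vectors [J_{e_i} x]. Their Gram matrix is a nonzero multiple of [S2], so
   [W] has rank [m]; if [n <= m] they span everything, and [x], orthogonal to them all, is in the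
   radical of [S1]. *)
pose W : 'M[R]_(m, n) := \matrix_(i < m) (J (delta_mx i 0) *m x)^T.
have WE i : row i W = (J (delta_mx i 0) *m x)^T by rewrite rowK.
have gram : W *m S1 *m W^T = bform S1 x x *: S2.
  have WTE i : W^T *m delta_mx i 0 = J (delta_mx i 0) *m x.
    by rewrite -colE -tr_row WE trmxK.
  apply/matrixP=> i j; rewrite [RHS]mxE -(bform_delta S2) -J_gram -bform_delta.
  by rewrite /bform -!WTE trmx_mul trmxK !mulmxA.
have rW : row_full W.
  rewrite /row_full eqn_leq rank_leq_col.
  apply: (leq_trans n_le_m); apply: (leq_trans _ (mxrankM_maxl W (S1 *m W^T))).
  by rewrite mulmxA gram mxrank_scale_nz // mxrank_unit.
have Wx : W *m (S1 *m x) = 0.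
  apply/row_matrixP=> i; rewrite row_mul WE row0.
  apply/rowP=> j; rewrite ord1 mulmxA -[LHS]/(bform S1 _ x) J_orthogonal.
  by rewrite mxE.
have /row_fullP[B BW] := rW.
have S1x : S1 *m x = 0 by rewrite -[_ *m _]mul1mx -BW -mulmxA Wx mulmx0.
by case/eqP: xx; rewrite /bform -mulmxA S1x mulmx0 mxE.
Qed.

(** For odd [n] the skew matrix [S1 *m J z] is singular, whereas [J z] squares to a nonzero scalar
    when [z] is anisotropic. *)
Lemma dim_generators_even : (0 < m)%N -> ~~ odd n.
Proof.
move=> m_gt0; apply/negP => n_odd.
have [z zz] := exists_anisotropic m_gt0 S2sym S2unit.
have J2 : J z *m J z = (- bform S2 z z)%:M.
  have := JJ z z; set M := J z *m J z => /matrixP E; apply/matrixP=> i j.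
  by move: (E i j); rewrite mxE !mxE; case: (i == j); rewrite ?mulr1n ?mulr0n; lra.
have : \det (S1 *m J z) == 0.
  have := congr1 determinant (trJ_skew z).
  rewrite -scaleN1r detZ !det_mulmx det_tr -signr_odd n_odd expr1.
  set a := \det _; set b := \det _ => E; apply/eqP; lra.
rewrite det_mulmx mulf_eq0; move: S1unit; rewrite unitmxE unitfE => /negPf-> /=.
move/eqP => dJ; move/(congr1 determinant)/eqP: J2.
rewrite det_mulmx dJ mul0r det_scalar eq_sym expf_eq0 oppr_eq0 (negPf zz).
by rewrite andbF.
Qed.

(** Pairing with [invmx S2 *m delta_mx k 0] under [S2] extracts the [k]-th coordinate of the
    bracket. *)
Lemma struct_const_J k : A k = - (S1 *m J (invmx S2 *m delta_mx k 0)).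
Proof.
rewrite -trJ_skew trJ_mul trmx_mul trmx_delta trmx_inv S2sym mulmxKV //.
rewrite (bigD1 k) //= big1 ?addr0 => [|l neq_lk]; rewrite !mxE ?eqxx ?scale1r //.
by rewrite (negPf neq_lk) andbF scale0r.
Qed.

(* The J-operators satisfy (J_z J_w)^2 = - 2 <z,w> J_z J_w - <z,z> <w,w>, and
   A_k^-1 A_l is proportional to J_z J_w. *)
Lemma pencil_quadratic k l : (0 < n)%N -> \det (A k) != 0 ->
  exists a b, let B := \adj (A k) *m A l in B *m B = a *: B + b%:M.
Proof.
move=> n_gt0 dA; cbv zeta; set B := \adj (A k) *m A l.
set U := J (invmx S2 *m delta_mx k 0); set V := J (invmx S2 *m delta_mx l 0).
set d := \det (A k) in dA.
have [g [h [e [UU VV UV]]]] : exists g h e, [/\ U *m U = g%:M, V *m V = h%:M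
    & V *m U = e%:M - U *m V].
  have half (M : 'M[R]_n) c : M + M = (- 2 * c)%:M -> M = (- c)%:M.
    move=> /matrixP E; apply/matrixP=> i j; move: (E i j); rewrite mxE !mxE.
    by case: (i == j); rewrite ?mulr1n ?mulr0n; lra.
  set zk := invmx S2 *m delta_mx k 0 in U *.
  set zl := invmx S2 *m delta_mx l 0 in V *.
  exists (- bform S2 zk zk), (- bform S2 zl zl), (- 2 * bform S2 zk zl).
  split; [exact: half (JJ _ _)|exact: half (JJ _ _)|].
  by rewrite -JJ addrC addKr.
have gN0 : g != 0.
  apply: contraNneq dA => g0.
  have : \det U == 0.
    have := congr1 determinant UU; rewrite g0 det_mulmx det_scalar expr0n.
    by rewrite eqn0Ngt n_gt0 /= => /eqP; rewrite mulf_eq0 orbb.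
  by move/eqP=> U0; rewrite /d struct_const_J -scaleN1r detZ det_mulmx U0 !mulr0.
(* The factor [d] comes from using the adjugate in place of the inverse; multiplying by [U] on the
   left then gives [g *: B = d *: (U *m V)]. *)
have UB : U *m B = d *: V.
  have U_A : U = - (invmx S1 *m A k) by rewrite struct_const_J mulmxN opprK mulKmx.
  have V_A : V = - (invmx S1 *m A l) by rewrite struct_const_J mulmxN opprK mulKmx.
  rewrite U_A V_A /B mulNmx -mulmxA [A k *m _]mulmxA mul_mx_adj mul_scalar_mx.
  by rewrite -scalemxAr scalerN.
have BE : B = (d / g) *: (U *m V).
  have : g *: B = d *: (U *m V) by rewrite -mul_scalar_mx -UU -mulmxA UB -scalemxAr.
  by move=> E; apply: (scalerI gN0); rewrite E scalerA mulrC divfK.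
exists (d / g * e), (- (d / g) ^+ 2 * g * h).
(* [U (V U) V = U (e - U V) V = e U V - U^2 V^2]. *)
have UVUV : U *m V *m (U *m V) = e *: (U *m V) - (g * h)%:M.
  rewrite mulmxA -[U *m V *m U]mulmxA UV mulmxBr mulmxBl mul_mx_scalar -scalemxAl.
  by rewrite mulmxA UU mul_scalar_mx -scalemxAl VV scale_scalar_mx.
rewrite {1 2}BE -scalemxAl -scalemxAr scalerA UVUV scalerBr BE !scalerA.
rewrite -expr2 scale_scalar_mx; congr (_ *: _ + _); first by ring.
by rewrite -raddfN /=; congr (_%:M); ring.
Qed.

End JMap.

(** * A polynomial test on pencils *)

(* With B = adj X * Y, the diagonals of 1, B and B^2 at i, j, l are linearly
   dependent when B^2 is a combination of B and 1. *)
Definition pencil_test (K : comNzRingType) n (X Y : 'M[K]_n) (i j l : 'I_n) : K :=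
  let B := \adj X *m Y in let C := B *m B in
  \det X * ((B j j - B i i) * (C l l - C i i) - (B l l - B i i) * (C j j - C i i)).

(** Evaluating the test polynomial at an algebra thus amounts to testing its own structure
    matrices. *)
Lemma rmorph_pencil_test (K L : comNzRingType) (f : {rmorphism K -> L}) n
    (X Y : 'M[K]_n) i j l :
  f (pencil_test X Y i j l) = pencil_test (map_mx f X) (map_mx f Y) i j l.
Proof.
by rewrite /pencil_test -map_mx_adj -!map_mxM det_map_mx !mxE
  !(rmorphM, rmorphB) /=.
Qed.

(** The constant [b] cancels in differences of diagonal entries, so those of [B^2] are [a] times
    those of [B] and the 2 by 2 determinant vanishes. *)
Lemma pencil_test_eq0 (F : fieldType) n (X Y : 'M[F]_n) i j l :
  (exists a b, let B := \adj X *m Y in B *m B = a *: B + b%:M) ->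
  pencil_test X Y i j l = 0.
Proof.
move=> [a [b /= BB]]; rewrite /pencil_test /= BB.
set B := _ *m _.
have E k : (a *: B + b%:M) k k = a * B k k + b by rewrite !mxE eqxx mulr1n.
by rewrite !E; ring.
Qed.

(** The variables are numbered by nested [mxvec_index] to match [sc_coords]. *)
Definition generic_mx (R : realType) m n (k : 'I_m) : 'M[{mpoly R[m * (n * n)]}]_n :=
  \matrix_(i, j) 'X_(mxvec_index k (mxvec_index i j)).

Lemma meval_generic_mx (R : realType) m n (A : struct_const R m n) k :
  map_mx (meval (sc_coords A)) (generic_mx R n k) = A k.
Proof. by apply/matrixP=> i j; rewrite !mxE mevalXU /sc_coords mxvecE mxE mxvecE. Qed.

(** * Constructing algebras with surjective bracket *)

Lemma card_ltn_pairs n : #|[set p : 'I_n * 'I_n | p.1 < p.2]%N| = 'C(n, 2).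
Proof.
rewrite cardsE -sum1_card -(pair_big_dep xpredT (fun i j : 'I_n => i < j)%N
  (fun _ _ => 1%N)) /= (exchange_big_dep xpredT) //= -bin2_sum big_mkord.
apply: eq_bigr => j _.
by rewrite -(big_ord_widen n (fun=> 1%N) (ltnW (ltn_ord j))) sum1_card card_ord.
Qed.

(** Independence of the [A k] gives a right inverse [B] of the matrix whose rows are the flattened
    [A k]; the required coefficients are the entries of [B *m v]. *)
Lemma free_bracket_surjective (R : realType) m n (A : struct_const R m n) :
  (forall v : 'rV_m, \sum_k v 0 k *: A k = 0 -> v = 0) -> bracket_surjective A.
Proof.
move=> Afree v; pose W : 'M[R]_(m, n * n) := \matrix_(k < m) mxvec (A k).
have /row_freeP[B WB] : row_free W.
  apply: inj_row_free => w wW; apply: Afree; apply: (can_inj mxvecK).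
  rewrite linear_sum linear0 -[RHS]wW mulmx_sum_row; apply: eq_bigr => k _ /=.
  by rewrite linearZ /= rowK.
exists (vec_mx (B *m v)^T); apply/colP=> k.
rewrite -[LHS]/(v k 0) -[in LHS](mul1mx v) -WB -mulmxA mxE.
rewrite (reindex _ (curry_mxvec_bij _ _)) /= summxE.
under [RHS]eq_bigr do rewrite summxE.
rewrite pair_bigA /=; apply: eq_bigr => -[i j] _ /=.
rewrite [RHS]mxE [vec_mx _ _ _]mxE [_^T _ _]mxE.
rewrite [bracket _ _ _ _ _]mxE -[X in _ = _ * X]/(bform _ _ _) bform_delta.
by rewrite [W _ _]mxE mxvecE mulrC.
Qed.

(** In a vanishing combination, the entry at [pos k] reads off the [k]-th coefficient once the
    earlier ones are known to vanish. *)
Lemma triangular_bracket_surjective (R : realType) m n (A : struct_const R m n)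
    (pos : 'I_m -> 'I_n * 'I_n) :
  (forall k, A k (pos k).1 (pos k).2 = 1) ->
  (forall k l : 'I_m, (l < k)%N -> A k (pos l).1 (pos l).2 = 0) ->
  bracket_surjective A.
Proof.
move=> A1 A0; apply: free_bracket_surjective => v /matrixP vA.
suff v0 d : forall k : 'I_m, (k < d)%N -> v 0 k = 0.
  by apply/rowP=> k; rewrite mxE (v0 m).
elim: d => // d IHd k; rewrite ltnS leq_eqVlt => /orP[/eqP kd|]; last exact: IHd.
have := vA (pos k).1 (pos k).2; rewrite summxE mxE (bigD1 k) //= mxE A1 mulr1.
rewrite big1 ?addr0 // => l neq_lk; rewrite mxE.
case: (ltngtP l k) => [lk|kl|/val_inj lk].
- by rewrite IHd ?mul0r // -kd.
- by rewrite A0 ?mulr0.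
- by rewrite lk eqxx in neq_lk.
Qed.

Definition elem_skew (R : realType) n (p : 'I_n * 'I_n) : 'M[R]_n :=
  delta_mx p.1 p.2 - delta_mx p.2 p.1.

Lemma elem_skew_tr (R : realType) n (p : 'I_n * 'I_n) :
  (elem_skew R p)^T = - elem_skew R p.
Proof. by rewrite /elem_skew linearB /= !trmx_delta opprB. Qed.

Lemma elem_skewE (R : realType) n (p q : 'I_n * 'I_n) :
  (p.1 < p.2)%N -> (q.1 < q.2)%N -> elem_skew R p q.1 q.2 = (q == p)%:R.
Proof.
case: p q => [i j] [a b] /= ij ab; rewrite !mxE xpair_eqE /=.
have /negPf-> : ~~ ((a == j) && (b == i)).
  by apply/negP => /andP[/eqP aj /eqP bi]; move: ab; rewrite aj bi; lia.
by rewrite subr0.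
Qed.

(** [X] and [Y] are completed by elementary skew matrices at other positions above the diagonal;
    listing [p] and [q] first makes the family triangular. *)
Lemma exists_algebra_extending (R : realType) m n (p q : 'I_n * 'I_n)
    (X Y : 'M[R]_n) :
  (m.+2 <= 'C(n, 2))%N -> (p.1 < p.2)%N -> (q.1 < q.2)%N -> p != q ->
  X^T = - X -> Y^T = - Y ->
  X p.1 p.2 = 1 -> Y p.1 p.2 = 0 -> Y q.1 q.2 = 1 ->
  exists A : struct_const R m.+2 n,
    [/\ skew_consts A, bracket_surjective A,
        A ord0 = X & A (lift ord0 ord0) = Y].
Proof.
move=> m_le p_lt q_lt neq_pq Xskew Yskew Xp Yp Yq.
pose S := [set r : 'I_n * 'I_n | r.1 < r.2]%N.
pose s := p :: q :: enum (S :\ p :\ q).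
have s_uniq : uniq s.
  by rewrite /= enum_uniq !inE !mem_enum !inE !eqxx (negPf neq_pq).
have s_size : size s = 'C(n, 2).
  rewrite /= -cardE -card_ltn_pairs -/S (cardsD1 p S) (cardsD1 q (S :\ p)).
  by rewrite !inE p_lt q_lt eq_sym neq_pq.
(* The default value [p] of [nth] also lies above the diagonal, so no bound on [k] is required. *)
have s_lt k : ((nth p s k).1 < (nth p s k).2)%N.
  have [ks|ks] := ltnP k (size s); last by rewrite nth_default.
  have := mem_nth p ks; rewrite !inE => /or3P[/eqP->|/eqP->|] //.
  by rewrite mem_enum !inE => /and3P[].
pose A (k : 'I_m.+2) := match val k with
  | 0 => X | 1 => Y | _ => elem_skew R (nth p s k) end.
exists A; split => //.
  by case=> [[|[|k]] ltk]; rewrite /A /= ?elem_skew_tr.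
apply: (@triangular_bracket_surjective _ _ _ _ (fun k => nth p s k)).
  by case=> [[|[|k]] ltk] //; rewrite /A elem_skewE ?eqxx.
move=> k l lt_lk; case: (ltnP 1 k) => [k_gt1|k_le1].
  have -> : A k = elem_skew R (nth p s k).
    by rewrite /A; case: (k) k_gt1 => [[|[|]]].
  rewrite elem_skewE // nth_uniq ?s_size ?(leq_trans (ltn_ord _)) //.
  by rewrite (ltn_eqF lt_lk).
(* The one remaining pair is [Y] at position [p], covered by [Yp]. *)
have [k1 l0] : k = 1%N :> nat /\ l = 0%N :> nat by split; lia.
by rewrite /A /= k1 l0.
Qed.

Lemma exists_algebra (R : realType) m n :
  (1 < m)%N -> (m <= 'C(n, 2))%N ->
  exists A : struct_const R m n, skew_consts A /\ bracket_surjective A.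
Proof.
case: m => [|[|m]] // _; case: n => [|[|[|n]]] //.
move=> m_le.
pose i0 : 'I_n.+3 := inord 0; pose i1 : 'I_n.+3 := inord 1.
pose i2 : 'I_n.+3 := inord 2.
have lt01 : (i0 < i1)%N by rewrite !inordK.
have lt02 : (i0 < i2)%N by rewrite !inordK.
have neq12 : i1 != i2 by rewrite -val_eqE /= !inordK.
have neq : (i0, i1) != (i0, i2) by rewrite xpair_eqE eqxx.
have [|||A [Askew Asurj _ _]] := @exists_algebra_extending R m _ (i0, i1) (i0, i2)
    (elem_skew R (i0, i1)) (elem_skew R (i0, i2)) m_le lt01 lt02 neq
    (elem_skew_tr _ _) (elem_skew_tr _ _).
- by rewrite elem_skewE ?eqxx.
- by rewrite elem_skewE ?(negPf neq).
- by rewrite elem_skewE ?eqxx.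
- by exists A.
Qed.

(** * A skew pencil passing the test *)

(* [symp_mx] is block diagonal with blocks [[0, 1], [-1, 0]], and [weights] is
   (0, 0, 1, 1, 2, 2, ...). *)
Definition partner (i : nat) : nat := if odd i then i.-1 else i.+1.

Definition symp_mx (R : realType) n : 'M[R]_n :=
  \matrix_(i, j) ((-1) ^+ i *+ (partner i == j)).

Definition weights (R : realType) n : 'rV[R]_n := \row_i (i./2)%:R.

Lemma symp_mx_skew (R : realType) n : (symp_mx R n)^T = - symp_mx R n.
Proof.
apply/matrixP=> i j; rewrite !mxE.
have -> : (partner j == i) = (partner i == j).
  by rewrite /partner; case: ifP; case: ifP; lia.
have [ij|] := eqVneq (partner i) j; last by rewrite mulr0n oppr0.
rewrite !mulr1n -signr_odd -(signr_odd _ i) -ij /partner.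
by case: ifP => oi; rewrite ?oi /= -?subn1 ?oddB ?oi ?expr0 ?expr1 ?opprK //; lia.
Qed.

(** [partner] is an involution, preserving the indices below [n] because [n] is even, and it changes
    parity, so the two signs multiply to -1. *)
Lemma symp_mx_sqr (R : realType) n : ~~ odd n ->
  symp_mx R n *m symp_mx R n = (- 1)%:M.
Proof.
move=> n_even; apply/matrixP=> i j; rewrite !mxE.
have lt_pi : (partner i < n)%N.
  by rewrite /partner; have := ltn_ord i; case: ifP; lia.
rewrite (bigD1 (Ordinal lt_pi)) //= big1 ?addr0 => [|k]; last first.
  by rewrite -val_eqE !mxE /= eq_sym => /negPf->; rewrite mulr0n mul0r.
rewrite !mxE eqxx mulr1n /=.
have -> : partner (partner i) = i :> nat by rewrite /partner; case: ifP; case: ifP; lia.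
rewrite -val_eqE mulrnAr -exprD; congr (_ *+ _).
have odd_ip : odd (i + partner i) by rewrite /partner; case: ifP; lia.
by rewrite -signr_odd odd_ip expr1.
Qed.

(** Partners carry equal weights, so the diagonal matrix commutes with [symp_mx]. *)
Lemma symp_weighted_skew (R : realType) n :
  (symp_mx R n *m diag_mx (weights R n))^T = - (symp_mx R n *m diag_mx (weights R n)).
Proof.
rewrite trmx_mul tr_diag_mx symp_mx_skew mulmxN; congr (- _).
rewrite mul_mx_diag mul_diag_mx; apply/matrixP=> i j; rewrite !mxE.
have [ij|] := eqVneq (partner i) j; last by rewrite mulr0n mulr0 mul0r.
rewrite mulrC; congr (_ * _%:R); move: ij; rewrite /partner.
by case: ifP; lia.
Qed.

(** Here [B] is [\det X] times the diagonal matrix of weights, whose entries 0, 1, 2 at the chosen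
    indices are distinct; the test equals [2 (\det X)^4]. *)
Lemma pencil_test_symp (R : realType) n (i j l : 'I_n) : ~~ odd n ->
  i = 0%N :> nat -> j = 2%N :> nat -> l = 4%N :> nat ->
  pencil_test (symp_mx R n) (symp_mx R n *m diag_mx (weights R n)) i j l != 0.
Proof.
move=> n_even i0 j2 l4; set X := symp_mx R n; set D := diag_mx _.
have dX : \det X != 0.
  have := congr1 determinant (symp_mx_sqr R n_even).
  rewrite det_mulmx det_scalar -/X => dX2; apply/eqP => dX0.
  by move/eqP: dX2; rewrite dX0 mul0r eq_sym expf_eq0 oppr_eq0 oner_eq0 andbF.
have adjX : \adj X *m (X *m D) = \det X *: D.
  by rewrite mulmxA mul_adj_mx mul_scalar_mx.
rewrite /pencil_test adjX -scalemxAl -scalemxAr.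
rewrite scalerA mul_diag_mx; set d := \det X in dX *.
have BE k : (d *: D) k k = d * (k./2)%:R by rewrite !mxE eqxx mulr1n.
have CE k : ((d * d) *: (\matrix_(i, j) (weights R n 0 i * D i j))) k k =
    d * d * (k./2)%:R ^+ 2 by rewrite !mxE eqxx mulr1n.
cbv zeta; rewrite !BE !CE i0 j2 l4 /=.
have -> : d * ((d * 1%:R - d * 0%:R) * (d * d * 2%:R ^+ 2 - d * d * 0%:R ^+ 2) -
    (d * 2%:R - d * 0%:R) * (d * d * 1%:R ^+ 2 - d * d * 0%:R ^+ 2)) =
    2%:R * d ^+ 4 by ring.
by rewrite mulf_neq0 ?pnatr_eq0 // expf_neq0.
Qed.

(** * Genericity and the case analysis *)

Lemma generic_of_forall (R : realType) m n (Q : struct_const R m n -> Prop) :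
  (1 < m)%N -> (m <= 'C(n, 2))%N -> (forall A, skew_consts A -> Q A) ->
  generic_in_N Q.
Proof.
move=> m_gt1 m_le QA; exists 1; split; last by move=> A Askew _ _; apply: QA.
have [A [Askew Asurj]] := exists_algebra R m_gt1 m_le.
by exists A; split => //; rewrite meval1 oner_neq0.
Qed.

Unset Implicit Arguments.

Theorem theorem6p2 (R : realType) (m n : nat) :
  (1 < m)%N -> (m <= 'C(n, 2))%N ->
  ~ ((m, n) = (2, 4))%N -> ~ ((m, n) = (3, 4))%N ->
  generic_in_N (fun A : struct_const R m n => ~ pseudo_H_type A).
Proof.
move=> m_gt1 m_le neq24 neq34.
have n_gt0 : (0 < n)%N by case: (n) m_le m_gt1 => //; case: m {neq24 neq34}.
have [n_odd|n_even] := boolP (odd n).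
  apply: generic_of_forall => // A Askew
    [S1 [S2 [J [[S1s S1u] [S2s S2u] JP JJ]]]].
  have := dim_generators_even Askew S1s S2s S1u S2u JP JJ (ltnW m_gt1).
  by rewrite n_odd.
have [n_le_m|m_lt_n] := leqP n m.
  apply: generic_of_forall => // A Askew
    [S1 [S2 [J [[S1s S1u] [S2s S2u] JP JJ]]]].
  have := dim_center_lt Askew S1s S1u S2u JP JJ n_gt0.
  by rewrite ltnNge n_le_m.
(* Since [1 < m < n] and [n] is even, [n] is at least 4, and [n = 4] leaves only the two excluded
   pairs. *)
have n_gt4 : (4 < n)%N.
  have [n4|] := eqVneq n 4%N; last by lia.
  by case: m m_gt1 m_lt_n neq24 neq34 {m_le} => [|[|[|[|m]]]] //; rewrite n4.
case: m m_gt1 m_le {neq24 neq34 m_lt_n} => [|[|m]] // _ m_le.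
have lt k : (k <= 4)%N -> (k < n)%N by lia.
pose i k (k_le : (k <= 4)%N) : 'I_n := Ordinal (lt k k_le).
pose i0 := i 0%N isT; pose i1 := i 1%N isT; pose i2 := i 2%N isT.
pose i3 := i 3%N isT; pose i4 := i 4%N isT.
pose k0 : 'I_m.+2 := ord0; pose k1 : 'I_m.+2 := lift ord0 ord0.
exists (pencil_test (generic_mx R n k0) (generic_mx R n k1) i0 i2 i4); split.
  (* The weighted matrix has entry 0 at [(0, 1)], where the weight is 0, and entry 1 at [(2, 3)],
     where it is 1. *)
  have [|||A [Askew Asurj A0 A1]] := @exists_algebra_extending R m n (i0, i1)
    (i2, i3) _ _ m_le isT isT isT (symp_mx_skew R n) (symp_weighted_skew R n).
  - by rewrite !mxE expr0.
  - by rewrite mul_mx_diag !mxE /= mulr0.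
  - by rewrite mul_mx_diag !mxE /= mulr1 -signr_odd expr0.
  exists A; split => //; rewrite rmorph_pencil_test !meval_generic_mx A0 A1.
  exact: pencil_test_symp.
move=> A Askew _; rewrite rmorph_pencil_test !meval_generic_mx => test
  [S1 [S2 [J [[S1s S1u] [S2s S2u] JP JJ]]]].
(* The factor [\det X] in the test makes its nonvanishing force invertibility of the first structure
   matrix. *)
have dA : \det (A k0) != 0.
  by apply: contraNneq test; rewrite /pencil_test => ->; rewrite mul0r.
case/eqP: test; apply: pencil_test_eq0.
exact: (pencil_quadratic Askew S1s S2s S1u S2u JP JJ k1 n_gt0 dA).
Qed.
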